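(* Let $m\geq 2$ be an integer and let $R_\bullet$ be a simplicial ring such that every ring $R_k$, $k\geq 0$, satisfies the identity $x^m=x$. Then $$\pi_n(R_\bullet)=0\quad\text{for all } n>0.$$
   Context: The homotopy groups $\pi_n$ of a simplicial ring are those of its underlying simplicial abelian group, i.e. the homology groups of the normalized chain complex $N_n(R_\bullet)=\{x\in R_n \mid \partial_i(x)=0 \text{ for all } i>0\}$ with boundary map $N_n(R_\bullet)\to N_{n-1}(R_\bullet)$ induced by $\partial_0$. *)

(* Defs.v *)
From HB Require Import structures.
From mathcomp Require Import all_boot all_order all_algebra.
From mathcomp Require Import boolp.

Set Implicit Arguments.
Unset Strict Implicit.
Unset Printing Implicit Defensive.

Import GRing.Theory.
Local Open Scope ring_scope.

(* To avoid truncated subtraction and default ordinals, each identity is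
   reindexed so that all indices are total: [up i] is i + 1 and [wd i] is i in
   the next larger ordinal type.  For instance d_i d_j = d_{j-1} d_i for i < j
   is written with j = j' + 1, i <= j'. *)
Local Notation up i := (lift ord0 i).
Local Notation wd i := (widen_ord (leqnSn _) i).

Section SimplicialIdentities.
Variable X : nat -> Type.
Variable d : forall n, 'I_n.+2 -> X n.+1 -> X n.
Variable s : forall n, 'I_n.+1 -> X n -> X n.+1.

Record simplicial_identities : Prop := SimplicialIdentities {
  face_face : forall n (i j : 'I_n.+2) (x : X n.+2), (i <= j)%N ->
    d i (d (up j) x) = d j (d (wd i) x);
  face_degen_lt : forall n (i : 'I_n.+2) (j : 'I_n.+1) (x : X n.+1),
    (i <= j)%N -> d (wd i) (s (up j) x) = s j (d i x);
  face_degen_eq : forall n (i : 'I_n.+1) (x : X n), d (wd i) (s i x) = x;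
  face_degen_succ : forall n (i : 'I_n.+1) (x : X n), d (up i) (s i x) = x;
  face_degen_gt : forall n (i : 'I_n.+2) (j : 'I_n.+1) (x : X n.+1),
    (j < i)%N -> d (up i) (s (wd j) x) = s j (d i x);
  degen_degen : forall n (i j : 'I_n.+1) (x : X n), (i <= j)%N ->
    s (wd i) (s j x) = s (up j) (s i x)
}.
End SimplicialIdentities.

Record simplicialZmod := SimplicialZmod {
  szmod :> nat -> zmodType;
  zface : forall n, 'I_n.+2 -> {additive szmod n.+1 -> szmod n};
  zdegen : forall n, 'I_n.+1 -> {additive szmod n -> szmod n.+1};
  zsimplicial : simplicial_identities (fun n i => zface i : _ -> _)
                                      (fun n i => zdegen i : _ -> _)
}.

(* Rings are associative and unital, not necessarily commutative, and possibly
   zero; face and degeneracy maps preserve 1. *)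
Record simplicialRing := SimplicialRing {
  sring :> nat -> pzRingType;
  rface : forall n, 'I_n.+2 -> {rmorphism sring n.+1 -> sring n};
  rdegen : forall n, 'I_n.+1 -> {rmorphism sring n -> sring n.+1};
  rsimplicial : simplicial_identities (fun n i => rface i : _ -> _)
                                      (fun n i => rdegen i : _ -> _)
}.

Definition underlying_zmod (R : simplicialRing) : simplicialZmod :=
  @SimplicialZmod (fun n => R n)
    (fun n i => rface R i : {additive R n.+1 -> R n})
    (fun n i => rdegen R i : {additive R n -> R n.+1})
    (rsimplicial R).

Record chainComplex := ChainComplex {
  chain :> nat -> zmodType;
  bdry : forall n, {additive chain n.+1 -> chain n};
  bdry_bdry : forall n (x : chain n.+2), bdry n (bdry n.+1 x) = 0
}.

Section Homology.
Variable C : chainComplex.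

(* In degree 0 every chain is a cycle: the complex is extended by zero. *)
Definition cycle_pred n : {pred C n} :=
  match n with
  | 0 => xpredT
  | k.+1 => fun x => bdry C k x == 0
  end.

Fact cycle_zmod_closed n : zmod_closed (@cycle_pred n).
Proof.
case: n => [|n]; first by [].
split=> [|x y]; first by apply/eqP; rewrite raddf0.
by move=> /eqP bx /eqP b_y; apply/eqP; rewrite raddfB bx b_y subr0.
Qed.

HB.instance Definition _ n :=
  GRing.isZmodClosed.Build (C n) (@cycle_pred n) (cycle_zmod_closed n).

Record cycle n := Cycle { cycle_val : C n; _ : @cycle_pred n cycle_val }.
HB.instance Definition _ n := [isSub for @cycle_val n].
HB.instance Definition _ n := [Choice of cycle n by <:].
HB.instance Definition _ n := [SubChoice_isSubZmodule of cycle n by <:].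

Definition boundary_pred n : {pred cycle n} :=
  fun z => `[< exists y : C n.+1, bdry C n y = val z >].

Fact boundary_zmod_closed n : zmod_closed (@boundary_pred n).
Proof.
split=> [|x y]; first by apply/asboolP; exists 0; rewrite !raddf0.
move=> /asboolP[u ux] /asboolP[v vy].
by apply/asboolP; exists (u - v); rewrite raddfB /= ux vy.
Qed.

HB.instance Definition _ n :=
  GRing.isZmodClosed.Build (cycle n) (@boundary_pred n) (boundary_zmod_closed n).

Definition homology n : zmodType :=
  {ideal_quot @boundary_pred n}.

End Homology.

Section NormalizedComplex.
Variable A : simplicialZmod.

Definition normalized_pred n : {pred A n} :=
  match n with
  | 0 => xpredT
  | k.+1 => fun x => [forall i : 'I_k.+2, (0 < i)%N ==> (zface A i x == 0)]
  end.

Fact normalized_zmod_closed n : zmod_closed (@normalized_pred n).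
Proof.
case: n => [|n]; first by [].
split=> [|x y]; first by apply/forallP=> i; rewrite raddf0 eqxx implybT.
move=> /forallP Nx /forallP Ny; apply/forallP=> i; apply/implyP=> i_gt0.
have /eqP xi := implyP (Nx i) i_gt0; have /eqP yi := implyP (Ny i) i_gt0.
by rewrite raddfB xi yi subr0.
Qed.

HB.instance Definition _ n :=
  GRing.isZmodClosed.Build (A n) (@normalized_pred n) (normalized_zmod_closed n).

Record normalized n :=
  Normalized { normalized_val : A n; _ : @normalized_pred n normalized_val }.
HB.instance Definition _ n := [isSub for @normalized_val n].
HB.instance Definition _ n := [Choice of normalized n by <:].
HB.instance Definition _ n := [SubChoice_isSubZmodule of normalized n by <:].

Fact normalized_face0 n (x : normalized n.+1) :
  normalized_pred (zface A ord0 (val x)).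
Proof.
case: n x => [|n] [x Nx] //=; apply/forallP=> i; apply/implyP=> i_gt0.
have ff := face_face (zsimplicial A) x (leq0n i : (@ord0 n.+1 <= i)%N).
have /eqP xi := implyP (forallP Nx (lift ord0 i)) isT.
have e0 : widen_ord (leqnSn n.+2) ord0 = ord0 by exact: val_inj.
by rewrite /= xi raddf0 e0 in ff; rewrite -ff.
Qed.

Definition normalized_bdry_fun n (x : normalized n.+1) : normalized n :=
  Normalized (normalized_face0 x).

Fact normalized_bdry_zmod_morphism n : zmod_morphism (@normalized_bdry_fun n).
Proof. by move=> x y; apply: val_inj; rewrite !raddfB /= raddfB. Qed.

HB.instance Definition _ n :=
  GRing.isZmodMorphism.Build _ _ (@normalized_bdry_fun n)
    (@normalized_bdry_zmod_morphism n).

Fact normalized_bdry_bdry n (x : normalized n.+2) :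
  normalized_bdry_fun (normalized_bdry_fun x) = 0.
Proof.
apply: val_inj => /=; case: x => x Nx /=.
have ff := face_face (zsimplicial A) x (leqnn (@ord0 n.+1)).
have /eqP x1 := implyP (forallP Nx (lift ord0 ord0)) isT.
have e0 : widen_ord (leqnSn n.+2) ord0 = ord0 by exact: val_inj.
by rewrite /= x1 raddf0 e0 in ff; rewrite -ff.
Qed.

Definition normalized_complex : chainComplex :=
  @ChainComplex (fun n => normalized n : zmodType)
    (fun n => @normalized_bdry_fun n : {additive _ -> _})
    normalized_bdry_bdry.

End NormalizedComplex.

Definition homotopy_group (R : simplicialRing) n : zmodType :=
  homology (normalized_complex (underlying_zmod R)) n.

(* Main.v *)
Require Import Defs.
From mathcomp Require Import all_boot all_order all_algebra.
From mathcomp Require Import boolp.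
Import GRing.Theory.
Local Open Scope ring_scope.

(** The product of two classes of positive degree vanishes in homotopy: if
    [d_i x = 0] for all [i > 0] and [d_0 y = 0], then
    [w = s_0 x * (s_0 y - s_1 y)] satisfies [d_0 w = x * y] and [d_i w = 0] for
    all [i > 0].  A cycle [x] is such a product, since [x = x * x^(m-1)] and
    [d_0 (x^(m-1)) = (d_0 x)^(m-1) = 0] because [m >= 2]. *)

Lemma mul_normalized_bounds (R : simplicialRing) (n : nat) (x y : R n.+1) :
  (forall i : 'I_n.+2, (0 < i)%N -> rface R i x = 0) ->
  rface R ord0 y = 0 ->
  exists w : R n.+2, rface R ord0 w = x * y /\
    forall i : 'I_n.+3, (0 < i)%N -> rface R i w = 0.
Proof.
move=> x_norm y0.
have [_ d_lt d_eq d_succ d_gt _] := rsimplicial R.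
have wd0 k : widen_ord (leqnSn k.+1) ord0 = ord0 by exact: val_inj.
pose o1 : 'I_n.+2 := lift ord0 ord0.
exists (rdegen R ord0 x * (rdegen R ord0 y - rdegen R o1 y)).
split=> [|i i_gt0].
  have d0s0 z : rface R ord0 (rdegen R ord0 z) = z.
    by have := d_eq _ ord0 z; rewrite wd0.
  have := d_lt n ord0 ord0 y isT; rewrite wd0 y0 raddf0 => d0s1.
  by rewrite rmorphM rmorphB /= !d0s0 d0s1 subr0.
have [j ->] : exists j, i = lift ord0 j.
  by case: (unliftP ord0 i) i_gt0 => [j ->|->] // _; exists j.
(* Here [i] is j + 1. For j > 0 the first factor dies: d_{j+1} s_0 x = s_0 d_j x = 0. *)
have [j_gt0|] := ltnP 0 j.
  have := d_gt n j ord0 x j_gt0; rewrite wd0 x_norm // raddf0 => dx.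
  by rewrite rmorphM /= dx mul0r.
(* For i = 1 the second factor dies instead: d_1 s_0 y = y = d_1 s_1 y. *)
rewrite leqn0 => /eqP j0; have -> : j = ord0 by exact: val_inj.
have d1s1 : rface R (lift ord0 ord0) (rdegen R o1 y) = y.
  by rewrite -[RHS](d_eq n.+1 o1); congr (rface R _ _); exact: val_inj.
by rewrite rmorphM rmorphB /= d1s1 (d_succ _ ord0 y) subrr mulr0.
Qed.

Lemma homology_eq0 (C : chainComplex) (n : nat) :
  (forall z : Defs.cycle C n, exists y : C n.+1, bdry C n y = val z) ->
  forall a : homology C n, a = 0.
Proof.
move=> exact_n; elim/quotW=> z; rewrite -(raddf0 \pi_(homology C n)%qT).
(* Equality with the zero class means that [z - 0] lies in [boundary_pred]. *)
by apply/eqP; rewrite -Quotient.idealrBE subr0; apply/asboolP.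
Qed.

Theorem corollary2 (m : nat) (R : simplicialRing) :
  (2 <= m)%N ->
  (forall (k : nat) (x : R k), x ^+ m = x) ->
  forall n : nat, (0 < n)%N -> forall a : homotopy_group R n, a = 0.
Proof.
case: m => [|[|m]] // _ xm [|n] // _; apply: homology_eq0 => -[[x x_norm] x_cyc].
have xi (i : 'I_n.+2) : (0 < i)%N -> rface R i x = 0.
  by move=> i_gt0; apply/eqP; exact: implyP (forallP x_norm i) i_gt0.
have x0 : rface R ord0 x = 0 by have /(congr1 val) := eqP x_cyc.
(* After the case split the exponent is [m.+2], so the cofactor of [x] is [x ^+ m.+1]; its exponent
   is positive, hence [0 ^+ m.+1] is 0. *)
have [|w [w0 wi]] := mul_normalized_bounds R n x (x ^+ m.+1) xi.
  by rewrite rmorphXn /= x0 expr0n.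
have w_norm : normalized_pred (A := underlying_zmod R) (n := n.+2) w.
  by apply/forallP=> i; apply/implyP=> /wi /= ->.
exists (Normalized w_norm); apply: val_inj.
by rewrite /= w0 -exprS xm.
Qed.
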